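(* Let $F\colon\mathbf C\to\mathbf D$ be left adjoint to $U\colon\mathbf D\to\mathbf C$ (with $\mathbf C,\mathbf D$ having finite coproducts) and let $\mathbb S$ be an Elgot monad on $\mathbf D$. Then the monad induced on the composite functor $USF$ is an Elgot monad.
   Context: An Elgot monad is a monad $\mathbb S$ (unit $\eta$, Kleisli lifting $(-)^*$) with an operator assigning to every $f\colon X\to S(Y+X)$ a morphism $f^\dagger\colon X\to SY$ such that: fixpoint $f^\dagger=[\eta,f^\dagger]^*\circ f$; naturality $g^*\circ f^\dagger=([S(\mathrm{inl})\circ g,\eta\circ\mathrm{inr}]^*\circ f)^\dagger$ for $g\colon Y\to SZ$; codiagonal $(S[\mathrm{id},\mathrm{inr}]\circ f)^\dagger=(f^\dagger)^\dagger$ for $f\colon X\to S((Y+X)+X)$; uniformity: $f\circ h=S(\mathrm{id}+h)\circ g$ implies $f^\dagger\circ h=g^\dagger$ for $g\colon Z\to S(Y+Z)$, $h\colon Z\to X$. The induced monad on $USF$ is the standard composite of the adjunction's monad structure with $\mathbb S$ (unit $U\eta_F\circ$ adjunction unit, multiplication $U\mu^{\mathbb S}_F\circ US(\text{counit})_{SF}$). *)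

(* Defs.v *)
From Corelib Require Import ssreflect.

Set Implicit Arguments.
Unset Strict Implicit.
Unset Printing Implicit Defensive.

Declare Scope cat_scope.
Delimit Scope cat_scope with cat.
Local Open Scope cat_scope.

Record category := Category {
  ob :> Type;
  hom : ob -> ob -> Type;
  id : forall X, hom X X;
  comp : forall X Y Z, hom Y Z -> hom X Y -> hom X Z;
  comp_idl : forall X Y (f : hom X Y), comp (id Y) f = f;
  comp_idr : forall X Y (f : hom X Y), comp f (id X) = f;
  comp_assoc : forall W X Y Z (h : hom Y Z) (g : hom X Y) (f : hom W X),
    comp h (comp g f) = comp (comp h g) f
}.
Arguments hom {c} X Y.
Arguments id {c} X.
Arguments comp {c X Y Z} g f.

Notation "X ~> Y" := (hom X Y) (at level 90, right associativity) : cat_scope.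
Notation "g ∘ f" := (comp g f) (at level 40, left associativity) : cat_scope.

Record functor (C D : category) := Functor {
  fobj :> C -> D;
  fmap : forall X Y, (X ~> Y) -> (fobj X ~> fobj Y);
  fmap_id : forall X, fmap (id X) = id (fobj X);
  fmap_comp : forall X Y Z (g : Y ~> Z) (f : X ~> Y),
    fmap (g ∘ f) = fmap g ∘ fmap f
}.
Arguments fmap {C D} F {X Y} f : rename.

Section CompFunctor.
Variables (C D E : category) (G : functor D E) (F : functor C D).

Lemma fcomp_id (X : C) : fmap G (fmap F (id X)) = id (G (F X)).
Proof. by rewrite !fmap_id. Qed.

Lemma fcomp_comp (X Y Z : C) (g : Y ~> Z) (f : X ~> Y) :
  fmap G (fmap F (g ∘ f)) = fmap G (fmap F g) ∘ fmap G (fmap F f).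
Proof. by rewrite !fmap_comp. Qed.

Definition fcomp : functor C E :=
  @Functor C E (fun X => G (F X)) (fun X Y f => fmap G (fmap F f))
    fcomp_id fcomp_comp.
End CompFunctor.

(* Chosen finite coproducts: an initial object and binary coproducts. *)
Record finite_coproducts (C : category) := FiniteCoproducts {
  zero : C;
  from_zero : forall X, zero ~> X;
  from_zero_uniq : forall X (f : zero ~> X), f = from_zero X;
  sum : C -> C -> C;
  inl : forall X Y, X ~> sum X Y;
  inr : forall X Y, Y ~> sum X Y;
  copair : forall X Y Z, (X ~> Z) -> (Y ~> Z) -> (sum X Y ~> Z);
  copair_inl : forall X Y Z (f : X ~> Z) (g : Y ~> Z), copair f g ∘ inl X Y = f;
  copair_inr : forall X Y Z (f : X ~> Z) (g : Y ~> Z), copair f g ∘ inr X Y = g;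
  copair_uniq : forall X Y Z (f : X ~> Z) (g : Y ~> Z) (h : sum X Y ~> Z),
    h ∘ inl X Y = f -> h ∘ inr X Y = g -> h = copair f g
}.
Arguments inl {C} f {X Y} : rename.
Arguments inr {C} f {X Y} : rename.
Arguments copair {C} f {X Y Z} : rename.

Definition sum_map (C : category) (cp : finite_coproducts C) (X X' Y Y' : C)
    (f : X ~> X') (g : Y ~> Y') : sum cp X Y ~> sum cp X' Y' :=
  copair cp (inl cp ∘ f) (inr cp ∘ g).

Record adjunction (C D : category) (F : functor C D) (U : functor D C) :=
  Adjunction {
  aunit : forall X : C, X ~> U (F X);
  acounit : forall A : D, F (U A) ~> A;
  aunit_nat : forall (X Y : C) (f : X ~> Y),
    aunit Y ∘ f = fmap U (fmap F f) ∘ aunit X;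
  acounit_nat : forall (A B : D) (f : A ~> B),
    acounit B ∘ fmap F (fmap U f) = f ∘ acounit A;
  triangle_l : forall X : C, acounit (F X) ∘ fmap F (aunit X) = id (F X);
  triangle_r : forall A : D, fmap U (acounit A) ∘ aunit (U A) = id (U A)
}.

Record monad (C : category) := Monad {
  mfun :> functor C C;
  munit : forall X, X ~> mfun X;
  mmul : forall X, mfun (mfun X) ~> mfun X;
  munit_nat : forall X Y (f : X ~> Y), munit Y ∘ f = fmap mfun f ∘ munit X;
  mmul_nat : forall X Y (f : X ~> Y),
    mmul Y ∘ fmap mfun (fmap mfun f) = fmap mfun f ∘ mmul X;
  mmul_unitl : forall X, mmul X ∘ munit (mfun X) = id (mfun X);
  mmul_unitr : forall X, mmul X ∘ fmap mfun (munit X) = id (mfun X);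
  mmul_assoc : forall X, mmul X ∘ mmul (mfun X) = mmul X ∘ fmap mfun (mmul X)
}.

Definition klift (C : category) (T : monad C) (X Y : C) (f : X ~> T Y) :
  T X ~> T Y := mmul T Y ∘ fmap T f.

Section Elgot.
Variables (C : category) (cp : finite_coproducts C) (T : monad C).

Local Notation "X + Y" := (sum cp X Y) : cat_scope.
Local Notation "[ f , g ]" := (copair cp f g) : cat_scope.
Local Notation inl := (inl cp).
Local Notation inr := (inr cp).
Local Notation eta := (munit T).

Definition iteration_operator :=
  forall X Y : C, (X ~> T (Y + X)) -> (X ~> T Y).

Record elgot_axioms (dagger : iteration_operator) : Prop := ElgotAxioms {
  elgot_fixpoint : forall (X Y : C) (f : X ~> T (Y + X)),
    dagger X Y f = klift [eta Y, dagger X Y f] ∘ f;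
  elgot_naturality : forall (X Y Z : C) (f : X ~> T (Y + X)) (g : Y ~> T Z),
    klift g ∘ dagger X Y f =
    dagger X Z (klift [fmap T inl ∘ g, eta (Z + X) ∘ inr] ∘ f);
  elgot_codiagonal : forall (X Y : C) (f : X ~> T ((Y + X) + X)),
    dagger X Y (fmap T [id (Y + X), inr] ∘ f) =
    dagger X Y (dagger X (Y + X) f);
  elgot_uniformity : forall (X Y Z : C) (f : X ~> T (Y + X))
      (g : Z ~> T (Y + Z)) (h : Z ~> X),
    f ∘ h = fmap T (sum_map cp (id Y) h) ∘ g ->
    dagger X Y f ∘ h = dagger Z Y g
}.

Definition is_elgot_monad : Prop :=
  exists dagger : iteration_operator, elgot_axioms dagger.
End Elgot.

Section InducedMonad.
Variables (C D : category) (F : functor C D) (U : functor D C).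
Variables (adj : adjunction F U) (S : monad D).

Definition USF : functor C C := fcomp U (fcomp S F).

Definition induced_unit (X : C) : X ~> USF X :=
  fmap U (munit S (F X)) ∘ aunit adj X.

Definition induced_mul (X : C) : USF (USF X) ~> USF X :=
  fmap U (mmul S (F X)) ∘ fmap U (fmap S (acounit adj (S (F X)))).

Lemma induced_unit_nat (X Y : C) (f : X ~> Y) :
  induced_unit Y ∘ f = fmap USF f ∘ induced_unit X.
Proof.
rewrite /induced_unit /= -comp_assoc aunit_nat !comp_assoc -!fmap_comp.
by rewrite munit_nat.
Qed.

Lemma induced_mul_nat (X Y : C) (f : X ~> Y) :
  induced_mul Y ∘ fmap USF (fmap USF f) = fmap USF f ∘ induced_mul X.
Proof.
rewrite /induced_mul /= -!fmap_comp; congr fmap.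
rewrite -comp_assoc -fmap_comp acounit_nat fmap_comp !comp_assoc.
by rewrite mmul_nat.
Qed.

Lemma induced_mul_unitl (X : C) :
  induced_mul X ∘ induced_unit (USF X) = id (USF X).
Proof.
rewrite /induced_mul /induced_unit /= comp_assoc -!fmap_comp.
rewrite -comp_assoc -munit_nat comp_assoc mmul_unitl comp_idl.
exact: triangle_r.
Qed.

Lemma induced_mul_unitr (X : C) :
  induced_mul X ∘ fmap USF (induced_unit X) = id (USF X).
Proof.
rewrite /induced_mul /induced_unit /= -!fmap_comp -fmap_id; congr fmap.
rewrite -comp_assoc -fmap_comp (fmap_comp F) comp_assoc acounit_nat.
by rewrite -comp_assoc triangle_l comp_idr mmul_unitr.
Qed.

Lemma induced_mul_assoc (X : C) :
  induced_mul X ∘ induced_mul (USF X) =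
  induced_mul X ∘ fmap USF (induced_mul X).
Proof.
rewrite /induced_mul /= -!fmap_comp; congr fmap.
rewrite -[RHS]comp_assoc -fmap_comp acounit_nat.
rewrite !fmap_comp !comp_assoc -mmul_assoc.
rewrite -[in LHS](comp_assoc (mmul S (F X))) -mmul_nat.
by rewrite !comp_assoc.
Qed.

Definition induced_monad : monad C :=
  Monad induced_unit_nat induced_mul_nat induced_mul_unitl
        induced_mul_unitr induced_mul_assoc.
End InducedMonad.

(* Main.v *)
(** Transposing along the adjunction turns [f : X ~> U (S (F (Y + X)))] into
    [F X ~> S (F (Y + X))]. As a left adjoint, [F] preserves coproducts, so this
    is a map [F X ~> S (F Y + F X)] to which the iteration operator of [S]
    applies; the result is transposed back. Each Elgot axiom for the induced
    monad transposes to the same axiom for [S], up to the comparison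
    [F (Y + X) ~> F Y + F X]. *)
From Corelib Require Import ssreflect.
Require Import Defs.

Set Implicit Arguments.
Unset Strict Implicit.
Unset Printing Implicit Defensive.

Local Open Scope cat_scope.

Section Coproducts.
Variables (C : category) (cp : finite_coproducts C).

Lemma copair_ext (X Y Z : C) (f g : sum cp X Y ~> Z) :
  f ∘ inl cp = g ∘ inl cp -> f ∘ inr cp = g ∘ inr cp -> f = g.
Proof.
move=> el er; rewrite (copair_uniq el er).
by symmetry; exact: copair_uniq.
Qed.

Lemma comp_copair (X Y Z W : C) (h : Z ~> W) (f : X ~> Z) (g : Y ~> Z) :
  h ∘ copair cp f g = copair cp (h ∘ f) (h ∘ g).
Proof. by apply: copair_uniq; rewrite -comp_assoc ?copair_inl ?copair_inr. Qed.

Lemma copair_sum_map (X X' Y Y' Z : C) (f : X' ~> Z) (g : Y' ~> Z)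
    (h : X ~> X') (k : Y ~> Y') :
  copair cp f g ∘ sum_map cp h k = copair cp (f ∘ h) (g ∘ k).
Proof. by rewrite /sum_map comp_copair !comp_assoc copair_inl copair_inr. Qed.
End Coproducts.

Section KleisliLifting.
Variables (C : category) (T : monad C).

Lemma klift_fmap (X Y Z : C) (g : Y ~> T Z) (f : X ~> Y) :
  klift g ∘ fmap T f = klift (g ∘ f).
Proof. by rewrite /klift -comp_assoc -fmap_comp. Qed.

Lemma fmap_klift (X Y Z : C) (g : Y ~> Z) (f : X ~> T Y) :
  fmap T g ∘ klift f = klift (fmap T g ∘ f).
Proof. by rewrite /klift comp_assoc -mmul_nat -comp_assoc -fmap_comp. Qed.

Lemma klift_munit_comp (X Y : C) (f : X ~> Y) :
  klift (munit T Y ∘ f) = fmap T f.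
Proof. by rewrite /klift fmap_comp comp_assoc mmul_unitr comp_idl. Qed.
End KleisliLifting.

(** Naturality along the Kleisli arrow [munit T Z ∘ g], whose lifting is [fmap T g]. It serves to
    move a pure map from outside an iteration into its body. *)
Lemma elgot_fmap (C : category) (cp : finite_coproducts C) (T : monad C)
    (dagger : iteration_operator cp T) (hd : elgot_axioms dagger)
    (X Y Z : C) (f : X ~> T (sum cp Y X)) (g : Y ~> Z) :
  fmap T g ∘ dagger X Y f =
  dagger X Z (fmap T (sum_map cp g (id X)) ∘ f).
Proof.
rewrite -klift_munit_comp (elgot_naturality hd) comp_assoc -munit_nat.
by rewrite -comp_assoc -comp_copair klift_munit_comp /sum_map comp_idr.
Qed.

Section Transposition.
Variables (C D : category) (F : functor C D) (U : functor D C).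
Variable adj : adjunction F U.

Definition transpose (X : C) (A : D) (f : X ~> U A) : F X ~> A :=
  acounit adj A ∘ fmap F f.

Definition untranspose (X : C) (A : D) (g : F X ~> A) : X ~> U A :=
  fmap U g ∘ aunit adj X.

Lemma untransposeK (X : C) (A : D) (g : F X ~> A) :
  transpose (untranspose g) = g.
Proof.
rewrite /transpose /untranspose fmap_comp comp_assoc acounit_nat.
by rewrite -comp_assoc triangle_l comp_idr.
Qed.

Lemma transposeK (X : C) (A : D) (f : X ~> U A) :
  untranspose (transpose f) = f.
Proof.
rewrite /transpose /untranspose fmap_comp -comp_assoc -aunit_nat.
by rewrite comp_assoc triangle_r comp_idl.
Qed.

Lemma transpose_inj (X : C) (A : D) (f g : X ~> U A) :
  transpose f = transpose g -> f = g.
Proof. by move=> e; rewrite -(transposeK f) e transposeK. Qed.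

Lemma transpose_fmap (X : C) (A B : D) (a : A ~> B) (f : X ~> U A) :
  transpose (fmap U a ∘ f) = a ∘ transpose f.
Proof.
by rewrite /transpose fmap_comp comp_assoc acounit_nat -comp_assoc.
Qed.

Lemma transpose_comp (X Y : C) (A : D) (f : Y ~> U A) (h : X ~> Y) :
  transpose (f ∘ h) = transpose f ∘ fmap F h.
Proof. by rewrite /transpose fmap_comp comp_assoc. Qed.

Variables (cpC : finite_coproducts C) (cpD : finite_coproducts D).

(** The images of the injections under [F] are jointly epic, because transposition is injective and
    natural in its source: the claim reduces to the uniqueness of copairings in [C]. *)
Lemma left_adjoint_copair_ext (X Y : C) (A : D)
    (f g : F (sum cpC X Y) ~> A) :
  f ∘ fmap F (inl cpC) = g ∘ fmap F (inl cpC) ->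
  f ∘ fmap F (inr cpC) = g ∘ fmap F (inr cpC) -> f = g.
Proof.
rewrite -(untransposeK f) -(untransposeK g) -!transpose_comp.
move=> /transpose_inj el /transpose_inj er.
by rewrite (copair_ext el er).
Qed.

Definition sum_comparison (X Y : C) :
    F (sum cpC X Y) ~> sum cpD (F X) (F Y) :=
  transpose (copair cpC (untranspose (inl cpD)) (untranspose (inr cpD))).

Lemma sum_comparison_inl (X Y : C) :
  sum_comparison X Y ∘ fmap F (inl cpC) = inl cpD.
Proof. by rewrite -transpose_comp copair_inl untransposeK. Qed.

Lemma sum_comparison_inr (X Y : C) :
  sum_comparison X Y ∘ fmap F (inr cpC) = inr cpD.
Proof. by rewrite -transpose_comp copair_inr untransposeK. Qed.

(** At [g] the identity, this makes the canonical map from [F X + F Y] to [F (X + Y)] a left inverse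
    of the comparison. The general form factors any map out of [F (X + Y)] through the
    comparison. *)
Lemma copair_sum_comparison (X Y : C) (A : D) (g : F (sum cpC X Y) ~> A) :
  copair cpD (g ∘ fmap F (inl cpC)) (g ∘ fmap F (inr cpC))
    ∘ sum_comparison X Y = g.
Proof.
apply: left_adjoint_copair_ext; rewrite -comp_assoc.
- by rewrite sum_comparison_inl copair_inl.
- by rewrite sum_comparison_inr copair_inr.
Qed.

Lemma transpose_copair (X Y : C) (A : D) (f : X ~> U A) (g : Y ~> U A) :
  transpose (copair cpC f g) =
  copair cpD (transpose f) (transpose g) ∘ sum_comparison X Y.
Proof.
rewrite -[LHS]copair_sum_comparison -!transpose_comp.
by rewrite copair_inl copair_inr.
Qed.

Lemma sum_comparison_copair (X Y Z W : C)
    (f : X ~> sum cpC Z W) (g : Y ~> sum cpC Z W) :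
  sum_comparison Z W ∘ fmap F (copair cpC f g) =
  copair cpD (sum_comparison Z W ∘ fmap F f) (sum_comparison Z W ∘ fmap F g)
    ∘ sum_comparison X Y.
Proof.
rewrite -[LHS]copair_sum_comparison -!comp_assoc -!fmap_comp.
by rewrite copair_inl copair_inr.
Qed.

Lemma sum_comparison_nat (X X' Y Y' : C) (f : X ~> X') (g : Y ~> Y') :
  sum_comparison X' Y' ∘ fmap F (sum_map cpC f g) =
  sum_map cpD (fmap F f) (fmap F g) ∘ sum_comparison X Y.
Proof.
rewrite sum_comparison_copair !fmap_comp !comp_assoc.
by rewrite sum_comparison_inl sum_comparison_inr.
Qed.

Variable S : monad D.
Local Notation T := (induced_monad adj S).

Lemma transpose_munit (X : C) :
  transpose (munit T X : X ~> U (S (F X))) = munit S (F X).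
Proof. exact: untransposeK. Qed.

(** With [transpose_fmap], this shows that transposition carries Kleisli composition of the induced
    monad to that of [S]. *)
Lemma induced_klift (X Y : C) (f : X ~> T Y) :
  klift f = fmap U (klift (transpose (f : X ~> U (S (F Y))))).
Proof.
by rewrite /klift /= /induced_mul /transpose -!fmap_comp -comp_assoc -fmap_comp.
Qed.

Variable dagger : iteration_operator cpD S.

Definition transposed_body (X Y : C) (f : X ~> T (sum cpC Y X)) :
    F X ~> S (sum cpD (F Y) (F X)) :=
  fmap S (sum_comparison Y X)
    ∘ transpose (f : X ~> U (S (F (sum cpC Y X)))).

Definition induced_dagger : iteration_operator cpC T :=
  fun X Y f => untranspose (dagger (transposed_body f)).

Lemma transpose_induced_dagger (X Y : C) (f : X ~> T (sum cpC Y X)) :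
  transpose (induced_dagger f : X ~> U (S (F Y))) =
  dagger (transposed_body f).
Proof. exact: untransposeK. Qed.

Lemma induced_elgot_axioms : elgot_axioms dagger -> elgot_axioms induced_dagger.
Proof.
move=> hd; split.
- move=> X Y f; apply: transpose_inj.
  rewrite [LHS]transpose_induced_dagger (elgot_fixpoint hd).
  rewrite induced_klift transpose_fmap transpose_copair transpose_munit.
  (* The comparison contained in the body is absorbed into the lifting, where it matches the one
     produced by transposing the copairing. *)
  by rewrite transpose_induced_dagger {2}/transposed_body comp_assoc klift_fmap.
- move=> X Y Z f g; apply: transpose_inj.
  rewrite induced_klift transpose_fmap !transpose_induced_dagger.
  rewrite (elgot_naturality hd); congr (dagger _).
  rewrite /transposed_body induced_klift transpose_fmap.
  rewrite [LHS]comp_assoc [RHS]comp_assoc klift_fmap fmap_klift.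
  congr (klift _ ∘ _).
  rewrite transpose_copair [RHS]comp_assoc comp_copair.
  congr (copair _ _ _ ∘ _).
  + by rewrite transpose_fmap [RHS]comp_assoc /= -fmap_comp sum_comparison_inl.
  + rewrite transpose_comp transpose_munit [RHS]comp_assoc -munit_nat.
    by rewrite -comp_assoc sum_comparison_inr.
- move=> X Y f; apply: transpose_inj.
  rewrite !transpose_induced_dagger {2}/transposed_body.
  (* The comparison between the two nested iterations blocks the codiagonal law of [S], so it is
     first pushed into the inner body. *)
  rewrite transpose_induced_dagger (elgot_fmap hd) -(elgot_codiagonal hd).
  congr (dagger _); rewrite /transposed_body transpose_fmap /=.
  rewrite [LHS]comp_assoc [RHS]comp_assoc [RHS]comp_assoc -!fmap_comp.
  congr (fmap S _ ∘ _).
  (* Both sides become the copairing of the comparison and [inr], precomposed with the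
     comparison. *)
  rewrite sum_comparison_copair copair_sum_map sum_comparison_inr.
  by rewrite fmap_id !comp_idr comp_idl.
- move=> X Y Z f g h e; apply: transpose_inj.
  rewrite transpose_comp !transpose_induced_dagger.
  (* Uniformity of [S] is used along [fmap F h]; its premise is the transpose of [e], by naturality
     of the comparison. *)
  apply: (elgot_uniformity hd).
  rewrite /transposed_body -comp_assoc -transpose_comp e transpose_fmap.
  rewrite [LHS]comp_assoc [RHS]comp_assoc /= -!fmap_comp.
  by rewrite sum_comparison_nat fmap_id.
Qed.
End Transposition.

Theorem theorem6p2 (C D : category)
    (cpC : finite_coproducts C) (cpD : finite_coproducts D)
    (F : functor C D) (U : functor D C) (adj : adjunction F U)
    (S : monad D) (hS : is_elgot_monad cpD S) :
  is_elgot_monad cpC (induced_monad adj S).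
Proof.
case: hS => dagger hd; exists (induced_dagger (adj := adj) dagger).
exact: induced_elgot_axioms.
Qed.
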